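(* Every consistent atomic RCC8 network over $\{\mathbf{EC},\mathbf{DC},\mathbf{NTPP},\mathbf{NTPP}^{-1}\}$ has a convex solution in $\mathbb{R}^3$.
   Context: A region in $\mathbb{R}^n$ ($n\geq 1$) is a nonempty regular closed subset $X$, i.e. $X=\mathrm{cl}(\mathrm{int}(X))$; write $i(X)$ for the interior. The eight RCC8 base relations between regions $a,b$ (jointly exhaustive and pairwise disjoint; $\subset$ denotes proper inclusion) are: $a\,\mathbf{EQ}\,b$: $a=b$; $a\,\mathbf{DC}\,b$: $a\cap b=\emptyset$; $a\,\mathbf{EC}\,b$: $a\cap b\neq\emptyset$ and $i(a)\cap i(b)=\emptyset$; $a\,\mathbf{PO}\,b$: $i(a)\cap i(b)\neq\emptyset$, $a\not\subseteq b$, $b\not\subseteq a$; $a\,\mathbf{TPP}\,b$: $a\subset b$ and $a\not\subset i(b)$; $a\,\mathbf{NTPP}\,b$: $a\subset i(b)$; and the converses $\mathbf{TPP}^{-1}$, $\mathbf{NTPP}^{-1}$ of the last two. Let $V$ be a finite set of variables. An RCC8 constraint is an expression $u\,R\,v$ with $u,v\in V$ and $R$ a nonempty set of base relations; an RCC8 network is a set of such constraints. It is atomic if for every pair of distinct variables $u,v$ it contains a constraint $u\,R\,v$ or $v\,R\,u$ with $R$ a singleton. It is a network over a set $\mathcal{R}$ of base relations if every constraint $u\,R\,v$ in it has $R\subseteq\mathcal{R}$. An $n$-dimensional solution (solution in $\mathbb{R}^n$) of a network is a map $\mathcal{S}$ from $V$ to regions of $\mathbb{R}^n$ such that for each constraint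 $u\,R\,v$ the base relation holding between $\mathcal{S}(u)$ and $\mathcal{S}(v)$ belongs to $R$. A network is consistent if it has a solution in $\mathbb{R}^n$ for some $n\geq 1$ (the regions need not be convex or connected). A solution is convex if every $\mathcal{S}(v)$ is a convex set. *)

(* Defs.v *)
From HB Require Import structures.
From mathcomp Require Import all_boot all_order all_algebra.
From mathcomp Require Import all_classical all_reals all_analysis.
Import numFieldNormedType.Exports.

Set Implicit Arguments.
Unset Strict Implicit.
Unset Printing Implicit Defensive.

Local Open Scope classical_set_scope.

Inductive rcc8 : Type :=
  EQ | DC | EC | PO | TPP | NTPP | TPPi | NTPPi.

Definition region (T : topologicalType) (X : set T) : Prop :=
  X !=set0 /\ regclosed X.

(* [A `<` B] is proper inclusion, in both occurrences in each of the clauses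
   for TPP and TPPi. *)
Definition rcc8_holds (T : topologicalType) (r : rcc8) (a b : set T) : Prop :=
  match r with
  | EQ => a = b
  | DC => a `&` b = set0
  | EC => a `&` b !=set0 /\ interior a `&` interior b = set0
  | PO => [/\ interior a `&` interior b !=set0, ~ (a `<=` b) & ~ (b `<=` a)]
  | TPP => a `<` b /\ ~ (a `<` interior b)
  | NTPP => a `<` interior b
  | TPPi => b `<` a /\ ~ (b `<` interior a)
  | NTPPi => b `<` interior a
  end.

Record rcc8_constraint (V : Type) := Constraint {
  lhs : V;
  rels : set rcc8;
  rhs : V;
  rels_neq0 : rels !=set0
}.

Definition rcc8_network (V : Type) := set (rcc8_constraint V).

Definition atomic (V : finType) (N : rcc8_network V) : Prop :=
  forall u v : V, u <> v ->
    exists c : rcc8_constraint V,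
      [/\ N c,
          (lhs c = u /\ rhs c = v) \/ (lhs c = v /\ rhs c = u) &
          exists r : rcc8, rels c = [set r]].

Definition network_over (V : finType) (B : set rcc8) (N : rcc8_network V) :
    Prop :=
  forall c : rcc8_constraint V, N c -> rels c `<=` B.

(* The base relations are jointly exhaustive and pairwise disjoint on regions
   of R^n, so the base relation holding between two regions belongs to
   [rels c] if and only if some member of [rels c] holds between them. *)
Definition solution (R : realType) (n : nat) (V : finType)
    (N : rcc8_network V) (S : V -> set 'rV[R]_n) : Prop :=
  (forall v : V, region (S v)) /\
  (forall c : rcc8_constraint V, N c ->
    exists2 r : rcc8, rels c r & rcc8_holds r (S (lhs c)) (S (rhs c))).

Definition consistent (R : realType) (V : finType) (N : rcc8_network V) :
    Prop :=
  exists2 n : nat, (1 <= n)%N & exists S : V -> set 'rV[R]_n, solution N S.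

Definition convex_solution (R : realType) (n : nat) (V : finType)
    (N : rcc8_network V) (S : V -> set 'rV[R]_n) : Prop :=
  solution N S /\ (forall v : V, convex_set (S v)).

(* Main.v *)
(* In the given solution NTPP is a forest order, and regions related by EC have
   the same NTPP-ancestors; these two facts suffice.

   Any graph E is the contact graph of convex bodies in R^3. To a vertex i
   attach a real t_i, any two of them at distance at least 1, and the affine
   function f_i(x) = t_i^4 + x_2 t_i^3 + x_1 t_i^2 + x_0 t_i of x. The body K_i
   is cut out of a large ball by the inequalities f_i <= f_k for the neighbours
   k of i and f_i + 1/2 <= f_k for the other k. If p_ij is read off the
   coefficients of (t - t_i)^2 (t - t_j)^2, then f_k(p_ij) is, up to a constant
   independent of k, equal to (t_k - t_i)^2 (t_k - t_j)^2; so p_ij is a common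
   point of K_i and K_j when ij is an edge, and p_ii is interior to K_i.

   Nesting is obtained by homotheties: with d(v) the number of ancestors of v
   and c_w the centre of K_w, the solution is
     S(v) = sum_(w ancestor of v) eps^d(w) c_w + eps^d(v) K_v
   for a small eps > 0. *)
Require Import Defs.
From mathcomp Require Import all_boot all_order all_algebra.
From mathcomp Require Import all_classical all_reals all_analysis.
From mathcomp Require Import ring lra.
Import Order.TTheory GRing.Theory Num.Theory numFieldNormedType.Exports.

Set Implicit Arguments.
Unset Strict Implicit.
Unset Printing Implicit Defensive.

Local Open Scope classical_set_scope.
Local Open Scope ring_scope.

(** * Convexity, interiors and regularity in normed spaces *)

Lemma convex_setP (R : realType) (E : lmodType R) (A : set E) :
  convex_set (A : set (convex_lmodType E)) <->
  forall (x y : E) (a : R), 0 <= a -> a <= 1 -> A x -> A y ->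
    A (a *: x + (1 - a) *: y).
Proof.
split=> [cA x y a a0 a1 Ax Ay|cA x y l /set_mem Ax /set_mem Ay].
  by have /set_mem := cA x y (Itv01 a0 a1) (mem_set Ax) (mem_set Ay).
apply: mem_set; apply: cA => //.
Qed.

Lemma interior_ballP (R : numFieldType) (E : normedModType R) (A : set E)
    (x : E) :
  interior A x <-> exists2 e : R, 0 < e & forall y, `|x - y| < e -> A y.
Proof.
split=> [/nbhs_ballP[e /= e0 xA]|[e e0 xA]].
  by exists e => // y xy; apply: xA; rewrite -ball_normE.
by apply/nbhs_ballP; exists e => //= y; rewrite -ball_normE; exact: xA.
Qed.

(** Contracting a ball around the interior point [c] towards a point [x] of [A] keeps it in [A] by
    convexity, so [x] is a limit of interior points. *)
Lemma convex_body_region (R : realType) (E : normedModType R) (A : set E) :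
  closed A -> convex_set (A : set (convex_lmodType E)) -> interior A !=set0 ->
  region A.
Proof.
move=> Acl /convex_setP Acv [c cA].
have /interior_ballP[e e0 ceA] := cA.
split; first by exists c; exact: interior_subset.
apply/seteqP; split.
  by move=> x /(closureS (@interior_subset _ _)); rewrite -(closure_id A).1.
move=> x Ax B /nbhs_ballP[d /= d0 dB].
have m0 : 0 < `|c - x| + d by rewrite ltr_wpDl.
(* This weight makes [s * |c - x|] smaller than [d], which puts [z] in the [d]-ball around [x]. *)
pose s := d / (`|c - x| + d).
have s0 : 0 < s by rewrite divr_gt0.
have s1 : s <= 1 by rewrite ler_pdivrMr// mul1r lerDr.
pose z := s *: c + (1 - s) *: x.
exists z; split.
  apply/interior_ballP; exists (s * e); first exact: mulr_gt0.
  move=> y zy.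
  have -> : y = s *: (c + s^-1 *: (y - z)) + (1 - s) *: x.
    by rewrite scalerDr scalerA divff ?gt_eqF// scale1r addrAC addrC subrK.
  apply: Acv => //; first exact: ltW.
  apply: ceA; rewrite opprD addNKr normrN normrZ gtr0_norm ?invr_gt0//.
  by rewrite mulrC ltr_pdivrMr// mulrC distrC.
apply: dB; rewrite -ball_normE /=.
have -> : z = x + s *: (c - x).
  by rewrite /z scalerBl scale1r addrCA -scalerBr.
rewrite opprD addNKr normrN normrZ gtr0_norm// /s mulrAC ltr_pdivrMr//.
by rewrite ltr_pM2l// ltrDl.
Qed.

(** * Bodies in three-space with a prescribed contact graph *)

Lemma row_coord_le (R : realType) (n : nat) (x : 'rV[R]_n) (j : 'I_n) :
  `|x 0 j| <= `|x|.
Proof.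
rewrite [leRHS]/Num.norm /= mx_normrE.
by apply: (le_bigmax _ (fun ij => `|x ij.1 ij.2|) (0, j)).
Qed.

(** The linear part of the affine function attached to the parameter [t]; the constant [t ^+ 4] is
    added separately. *)
Definition moment (R : realType) (t : R) (x : 'rV[R]_3) : R :=
  x 0 0 * t + x 0 1 * t ^+ 2 + x 0 2%:R * t ^+ 3.

(** The coefficients of [t], [t ^+ 2] and [t ^+ 3] in the expansion of
    [((t - a) * (t - b)) ^+ 2]. *)
Definition biquad (R : realType) (a b : R) : 'rV[R]_3 :=
  \row_j [:: - (2 * a * b * (a + b)); (a + b) ^+ 2 + 2 * a * b;
             - (2 * (a + b))]`_j.

Lemma biquadE (R : realType) (a b t : R) :
  t ^+ 4 + moment t (biquad a b) = ((t - a) * (t - b)) ^+ 2 - (a * b) ^+ 2.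
Proof. by rewrite /moment /biquad !mxE /=; ring. Qed.

Lemma moment_linear (R : realType) (t a b : R) (x y : 'rV[R]_3) :
  moment t (a *: x + b *: y) = a * moment t x + b * moment t y.
Proof. by rewrite /moment !mxE; ring. Qed.

Lemma moment_continuous (R : realType) (t : R) : continuous (@moment R t).
Proof.
move=> x; pose f (i : 'I_3) (a : R) (y : 'rV[R]_3) := y 0 i * a.
have cf i a : {for x, continuous (f i a)}.
  by apply: continuousM; [exact: coord_continuous|exact: cst_continuous].
have cf01 := @continuousD R R^o _ (f 0 t) (f 1 (t ^+ 2)) x (cf _ _) (cf _ _).
exact: (@continuousD R R^o _ _ (f 2%:R (t ^+ 3)) x cf01 (cf _ _)).
Qed.

(** A Lipschitz bound uniform in the parameter, from which the radius of an inner ball is chosen. *)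
Lemma moment_le (R : realType) (T t : R) (x : 'rV[R]_3) :
  `|t| <= T -> 1 <= T -> `|moment t x| <= 3 * T ^+ 3 * `|x|.
Proof.
move=> tT T1; have T0 : 0 <= T := le_trans ler01 T1.
have tk k : (k <= 3)%N -> `|t ^+ k| <= T ^+ 3.
  move=> k3; rewrite normrX (@le_trans _ _ (T ^+ k)) ?lerXn2r ?nnegrE//.
  by rewrite ler_weXn2l.
have ck (k : 'I_3) j : (j <= 3)%N -> `|x 0 k * t ^+ j| <= `|x| * T ^+ 3.
  by move=> j3; rewrite normrM ler_pM// ?row_coord_le// tk.
rewrite /moment -[t in _ * t]expr1.
apply: le_trans (ler_normD _ _) _.
have := ler_normD (x 0 0 * t ^+ 1) (x 0 1 * t ^+ 2).
have := ck 0 1%N isT; have := ck 1 2%N isT; have := ck 2%:R 3%N isT.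
lra.
Qed.


(** The square vanishes at both roots, so the constant [(a * b) ^+ 2] cancels in the difference. *)
Lemma biquad_gap (R : realType) (a b c t : R) : c = a \/ c = b ->
  (t ^+ 4 + moment t (biquad a b)) - (c ^+ 4 + moment c (biquad a b)) =
  ((t - a) * (t - b)) ^+ 2.
Proof. by rewrite !biquadE; case=> ->; ring. Qed.

Lemma rank_dist (R : realType) (V : finType) (u v : V) : u != v ->
  1 <= ((enum_rank u)%:R - (enum_rank v)%:R : R) ^+ 2.
Proof.
move=> uv; rewrite -real_normK ?num_real// -[leLHS](expr1n _ 2).
rewrite lerXn2r ?nnegrE//.
have : (enum_rank u)%:Z - (enum_rank v)%:Z != 0.
  by rewrite subr_eq0 eqz_nat (inj_eq val_inj) (inj_eq enum_rank_inj).
move: (enum_rank u : nat) (enum_rank v : nat) => m n mn.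
have -> : (m%:R - n%:R : R) = (m%:Z - n%:Z)%:~R by rewrite rmorphB.
by rewrite -intr_norm ler1z -gtz0_ge1 normr_gt0.
Qed.

(** Distinct ranks are integers at distance at least 1, so the gaps at the chosen points are 0 or at
    least 1. The margin 1/2 separates non-neighbours and still leaves room for an inner ball. *)
Definition contact_body (R : realType) (V : finType) (E : rel V) (M : R)
    (i : V) : set 'rV[R]_3 :=
  let t k : R := (enum_rank k)%:R in
  [set x | `|x| <= M /\ forall k, k != i ->
    t i ^+ 4 + moment (t i) x + (if E i k then 0 else 2^-1)
      <= t k ^+ 4 + moment (t k) x].

Lemma contact_body_closed (R : realType) (V : finType) (E : rel V) (M : R)
    (i : V) : closed (contact_body E M i).
Proof.
rewrite /contact_body /=; set t := fun k : V => ((enum_rank k)%:R : R).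
apply: closedI.
  apply: (@preimage_closed _ _ (fun x : 'rV[R]_3 => `|x|) [set y | y <= M]).
    by move=> x _; exact: norm_continuous.
  exact: closed_le.
have -> : (fun x : 'rV[R]_3 => forall k, k != i ->
    t i ^+ 4 + moment (t i) x + (if E i k then 0 else 2^-1)
      <= t k ^+ 4 + moment (t k) x) =
  \bigcap_(k in [set k | k != i])
    ((fun x : 'rV[R]_3 => moment (t k) x - moment (t i) x) @^-1`
     [set y | t i ^+ 4 + (if E i k then 0 else 2^-1) - t k ^+ 4 <= y]).
  apply/seteqP; split=> x /= xP k ki; have := xP k ki => /=; lra.
apply: closed_bigI => k _; apply: preimage_closed; last exact: closed_ge.
move=> x _.
exact: (@continuousB R R^o _ (moment (t k)) (moment (t i)) x
  (@moment_continuous _ _ _) (@moment_continuous _ _ _)).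
Qed.

Lemma contact_body_convex (R : realType) (V : finType) (E : rel V) (M : R)
    (i : V) : convex_set (contact_body E M i : set (convex_lmodType 'rV[R]_3)).
Proof.
apply/convex_setP => x y a a0 a1 [xM xP] [yM yP]; split.
  apply: le_trans (ler_normD _ _) _; rewrite !normrZ !ger0_norm ?subr_ge0//.
  have := ler_wpM2l a0 xM; have := @ler_wpM2l _ (1 - a) _ _ _ yM.
  rewrite subr_ge0 => /(_ a1); lra.
move=> k ki; rewrite !moment_linear.
have := ler_wpM2l a0 (xP k ki); have := @ler_wpM2l _ (1 - a) _ _ _ (yP k ki).
rewrite subr_ge0 => /(_ a1); nra.
Qed.

(** The last clause expresses that [K u] has no interior point in [K v]: a common point leaves [K u]
    under any positive move along [e]. This form carries over directly to homothetic copies. *)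
Lemma contact_family (R : realType) (V : finType) (E : rel V) :
  symmetric E ->
  exists (K : V -> set 'rV[R]_3) (c : V -> 'rV[R]_3) (M r : R),
  [/\ forall v, closed (K v),
      forall v, convex_set (K v : set (convex_lmodType 'rV[R]_3)),
      0 < r,
      forall v x, `|x - c v| <= r -> K v x &
      forall v x, K v x -> `|x| <= M] /\
  [/\ forall u v, u != v -> E u v -> K u `&` K v !=set0,
      forall u v, u != v -> ~~ E u v -> K u `&` K v = set0 &
      forall u v, u != v -> exists e : 'rV[R]_3, forall (z : 'rV[R]_3) (s : R),
        0 < s -> K u z -> K v z -> ~ K u (z + s *: e)].
Proof.
move=> Esym.
pose t (k : V) : R := (enum_rank k)%:R.
pose p i j := biquad (t i) (t j).
pose T : R := #|V|%:R + 1.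
have T1 : 1 <= T by rewrite lerDr.
have tT k : `|t k| <= T.
  by rewrite ger0_norm// (@le_trans _ _ #|V|%:R) ?lerDl// ler_nat ltnW.
pose D := 3 * T ^+ 3.
have D0 : 0 < D by rewrite mulr_gt0// exprn_gt0// (lt_le_trans ltr01).
pose M := 1 + \sum_i \sum_j `|p i j|.
have pM i j : 1 + `|p i j| <= M.
  rewrite lerD2l (bigD1 i)//= (bigD1 j)//= -addrA lerDl.
  by rewrite addr_ge0 ?sumr_ge0// => k _; rewrite sumr_ge0.
have gap1 i j k : k != i -> k != j ->
    1 <= ((t k - t i) * (t k - t j)) ^+ 2.
  move=> ki kj; rewrite exprMn -[leLHS]mulr1.
  by rewrite ler_pM ?rank_dist.
(* A shift of norm at most [r] changes each function by at most 1/8, hence a difference of two by at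
   most 1/4; a gap of 1 stays above 1/2. *)
pose r := (8 * D + 1)^-1.
have r0 : 0 < r by rewrite invr_gt0; lra.
have r1 : r <= 1 by rewrite invf_le1; lra.
have rD : 8 * (D * r) <= 1.
  by rewrite mulrA ler_pdivrMr; lra.
exists (contact_body E M), (fun i => p i i), M, r; split; split=> //.
- by move=> v; exact: contact_body_closed.
- by move=> v; exact: contact_body_convex.
- move=> v x xr; split.
    have := ler_normD (x - p v v) (p v v); have := pM v v; rewrite subrK; lra.
  move=> k kv; rewrite -/(t _) -/(t _).
  have -> : x = 1 *: p v v + 1 *: (x - p v v).
    by rewrite !scale1r addrC subrK.
  rewrite !moment_linear !mul1r.
  have := @biquad_gap _ (t v) (t v) _ (t k) (or_introl erefl).
  have := gap1 _ _ _ kv kv.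
  have := moment_le (x - p v v) (tT k) T1.
  have := moment_le (x - p v v) (tT v) T1.
  rewrite -/D !ler_norml -/(p v v).
  have := ler_wpM2l (ltW D0) xr.
  case: ifP => _; lra.
- by move=> v x [].
- move=> u v uv Euv; exists (p u v).
  have puvM : `|p u v| <= M by have := pM u v; lra.
  have gu k := @biquad_gap _ (t u) (t v) _ (t k) (or_introl erefl).
  have gv k := @biquad_gap _ (t u) (t v) _ (t k) (or_intror erefl).
  split; split=> // k ku; rewrite -/(t _) -/(t _).
    have := gu k; rewrite -/(p u v).
    have [->|kv] := eqVneq k v; first by rewrite Euv subrr mulr0 expr0n /=; lra.
    have := gap1 _ _ _ ku kv; case: ifP => _; lra.
  have := gv k; rewrite -/(p u v).
  have [->|ku'] := eqVneq k u.
    by rewrite Esym Euv subrr mul0r expr0n /=; lra.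
  have := gap1 _ _ _ ku' ku; case: ifP => _; lra.
- move=> u v uv /negbTE Euv; rewrite -subset0 => x [[_ xu] [_ xv]]; exfalso.
  have := xu v; rewrite eq_sym uv => /(_ isT); have := xv u uv.
  rewrite Esym Euv; lra.
- move=> u v uv.
  (* Along this vector the function of [u] minus that of [v] grows at rate [(t u - t v) ^+ 2],
     whereas it is 0 at a common point. *)
  exists ((t u - t v) *: \row_j [:: 1; 0; 0]`_j) => z s s0 [_ zu] [_ zv] [_ su].
  have := zv u uv; have := su v; rewrite eq_sym uv => /(_ isT).
  rewrite -/(t u) -/(t v) -[z]scale1r !moment_linear scale1r.
  have momE w :
      moment w ((t u - t v) *: \row_j [:: 1; 0; 0]`_j) = (t u - t v) * w.
    by rewrite /moment !mxE /=; ring.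
  rewrite !momE.
  have := mulr_gt0 s0 (lt_le_trans ltr01 (rank_dist R uv)).
  rewrite -/(t u) -/(t v).
  case: ifP => _; case: ifP => _; lra.
Qed.

(** * Nesting the bodies along a forest order *)

Lemma nested_family (R : realType) (V : finType) (lt E : rel V) :
  irreflexive lt -> transitive lt ->
  (forall u v w, lt u v -> lt u w -> [\/ v = w, lt v w | lt w v]) ->
  symmetric E -> (forall u v w, E u v -> lt u w -> lt v w) ->
  exists S : V -> set 'rV[R]_3,
  [/\ forall v, region (S v),
      forall v, convex_set (S v : set (convex_lmodType 'rV[R]_3)),
      forall u v, lt u v -> rcc8_holds NTPP (S u) (S v) &
      forall u v, u != v -> ~~ lt u v -> ~~ lt v u ->
        rcc8_holds (if E u v then EC else DC) (S u) (S v)].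
Proof.
move=> ltxx lttr tree Esym sib.
have [K [c [M [r [[Kcl Kcv r0 cK KM] [KE KN Ksep]]]]]] := contact_family R Esym.
have cM v : `|c v| <= `|M|.
  apply: le_trans (ler_norm M); apply: (KM v); apply: cK.
  by rewrite subrr normr0 ltW.
(* [n] counts at most [#|V|] ancestor terms and one term for the body itself; [eps] is chosen so
   that all of them together take at most half of the inner radius. *)
pose n : R := #|V|%:R + 1.
have n1 : 1 <= n by rewrite lerDr.
pose den := 2 * n * (`|M| + 1) + r.
have nM1 : 0 < n * (`|M| + 1).
  by rewrite mulr_gt0 ?ltr_wpDl// (lt_le_trans ltr01).
have den0 : 0 < den by rewrite /den; lra.
pose eps := r / den.
have eps0 : 0 < eps by rewrite divr_gt0.
have eps1 : eps <= 1 by rewrite ler_pdivrMr// /den; lra.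
have epsr : 2 * (n * `|M| * eps) <= r.
  have : eps * den = r by rewrite /eps divfK ?gt_eqF.
  have := mulr_gt0 eps0 r0.
  have : 0 < eps * n by rewrite mulr_gt0// (lt_le_trans ltr01).
  rewrite /den; lra.
pose d v := #|[pred w | lt v w]|.
have dlt u v : lt u v -> (d v < d u)%N.
  move=> uv; apply: proper_card; apply/properP; split.
    by apply/fintype.subsetP => w; rewrite !inE; exact: lttr.
  by exists v; rewrite !inE ?ltxx.
pose t v := \sum_(w | lt v w) eps ^+ d w *: c w.
pose S v : set 'rV[R]_3 := [set x | K v ((eps ^+ d v)^-1 *: (x - t v))].
have e0 k : 0 < eps ^+ k by rewrite exprn_gt0.
have SP v x : S v x -> exists2 y, K v y & x = t v + eps ^+ d v *: y.
  move=> Svx; exists ((eps ^+ d v)^-1 *: (x - t v)) => //.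
  by rewrite scalerA divff ?gt_eqF// scale1r addrC subrK.
have SK v y : K v y -> S v (t v + eps ^+ d v *: y).
  by rewrite /S /= addrAC subrr add0r scalerA mulVf ?gt_eqF// scale1r.
pose z v := t v + eps ^+ d v *: c v.
have zS v x : `|x - z v| <= eps ^+ d v * r -> S v x.
  move=> xz; apply: cK.
  have -> : (eps ^+ d v)^-1 *: (x - t v) - c v = (eps ^+ d v)^-1 *: (x - z v).
    by rewrite /z opprD addrA [in RHS]scalerBr scalerA mulVf ?gt_eqF// scale1r.
  by rewrite normrZ gtr0_norm ?invr_gt0// mulrC ler_pdivrMr// mulrC.
(* Descendants of [v] use only half of the inner ball of [S v]; the other half is what makes the
   inclusion in the interior strict. *)
have Sz u v x : lt u v -> S u x -> `|x - z v| <= eps ^+ d v * (r / 2).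
  move=> uv /SP[y Ky ->{x}].
  have ew w : lt w v -> `|eps ^+ d w| <= eps ^+ d v * eps.
    move=> wv; rewrite gtr0_norm// -exprSr.
    by rewrite ler_wiXn2l ?dlt// ltW.
  (* The ancestors of [v], with [v] itself, contribute exactly [z v]. By [tree], the remaining terms
     come from vertices between [u] and [v], whose scale is at most [eps ^+ d v * eps]. *)
  have -> : t u = z v +
      \sum_(w | lt u w && ~~ lt v w && (w != v)) eps ^+ d w *: c w.
    rewrite /t (bigID (lt v)) /= /z -addrA; congr (_ + _).
      apply: eq_bigl => w; apply/andb_idl; exact: lttr.
    by rewrite (bigD1 v) //= uv ltxx.
  rewrite addrAC [z v + _]addrC addrK.
  apply: (@le_trans _ _ (n * (eps ^+ d v * eps * `|M|))); last first.
    rewrite [n * _](_ : _ = eps ^+ d v * (n * `|M| * eps)); last by ring.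
    by rewrite ler_pM2l//; lra.
  rewrite mulrDl mul1r; apply: le_trans (ler_normD _ _) _; apply: lerD.
    apply: le_trans (ler_norm_sum _ _ _) _.
    apply: (@le_trans _ _ (\sum_(w : V) eps ^+ d v * eps * `|M|)).
      rewrite [leRHS](bigID (fun w => lt u w && ~~ lt v w && (w != v))) /=.
      rewrite -[leLHS]addr0; apply: lerD; last first.
        apply: sumr_ge0 => w _; apply: mulr_ge0 => //.
        by apply: mulr_ge0; exact: ltW.
      apply: ler_sum => w /andP[/andP[uw vw] wv].
      rewrite normrZ ler_pM// ew//.
      case: (tree u w v) => // [/eqP|vw']; first by rewrite (negbTE wv).
      by rewrite vw' in vw.
    by rewrite sumr_const mulr_natl.
  rewrite normrZ ler_pM ?ew//.
  exact: le_trans (KM _ _ Ky) (ler_norm M).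
have zint v x : `|x - z v| < eps ^+ d v * r -> interior (S v) x.
  move=> xz; apply/interior_ballP; exists (eps ^+ d v * r - `|x - z v|).
    by rewrite subr_gt0.
  move=> y xy; apply: zS.
  have := ler_normD (y - x) (x - z v); rewrite addrA subrK (distrC y x); lra.
have Sint u v x : lt u v -> S u x -> interior (S v) x.
  move=> uv Sux; apply: zint; apply: le_lt_trans (Sz _ _ _ uv Sux) _.
  by rewrite ltr_pM2l//; lra.
(* If p is an ancestor of u but not of w, then by induction the interior of S p,
   which contains S u, avoids S w; so only regions with the same ancestors can
   touch, and for these the statement is that about the bodies K. *)
have incomp m u v : (d u + d v < m)%N -> u != v -> ~~ lt u v -> ~~ lt v u ->
    [/\ E u v -> S u `&` S v !=set0, interior (S u) `&` S v = set0 &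
        ~~ E u v -> S u `&` S v = set0].
  (* Induction on a bound for the sum of the depths, which drops when one vertex is replaced by an
     ancestor. *)
  elim: m u v => // m IH u v; rewrite ltnS => duv uv luv lvu.
  have outer p w w' : (d p + d w < m)%N -> lt w' p -> ~~ lt w p -> ~~ lt w' w ->
      w != w' -> S w' `&` S w = set0.
    move=> dm w'p wp w'w ww'.
    have pw : p != w by apply: contraNneq w'w => <-.
    have lpw : ~~ lt p w by apply: contraNN w'w; exact: lttr.
    have [_ pw0 _] := IH _ _ dm pw lpw wp.
    by rewrite -subset0 -pw0; apply: setSI => x; exact: Sint.
  have [same|] := boolP [forall p, lt u p == lt v p]; last first.
    rewrite negb_forall => /existsP[p].
    have [up|up] := boolP (lt u p); have [vp|vp] := boolP (lt v p) => // _.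
      have uv0 : S u `&` S v = set0.
        apply: (outer p) => //; last by rewrite eq_sym.
        by rewrite (leq_trans _ duv)// ltn_add2r dlt.
      split=> // [Euv|]; first by rewrite (sib _ _ _ Euv up) in vp.
      rewrite -subset0 -uv0; apply: setSI; exact: interior_subset.
    have uv0 : S u `&` S v = set0.
      rewrite setIC; apply: (outer p) => //.
      by rewrite (leq_trans _ duv)// addnC ltn_add2l dlt.
    split=> // [Euv|].
      by rewrite Esym in Euv; rewrite (sib _ _ _ Euv vp) in up.
    rewrite -subset0 -uv0; apply: setSI; exact: interior_subset.
  (* Equal ancestors give equal translation and scale, so [S u] and [S v] are images of [K u] and
     [K v] under one homothety. *)
  have lt_uv : lt u =1 lt v by move=> p; exact/eqP/(forallP same).
  have duvE : d v = d u by apply: eq_card => w; rewrite !inE lt_uv.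
  have tuvE : t v = t u by apply: eq_bigl => w; rewrite lt_uv.
  split.
  - move=> Euv; have [y [Kuy Kvy]] := KE _ _ uv Euv.
    exists (t u + eps ^+ d u *: y); split; first exact: SK.
    by rewrite -tuvE -duvE; exact: SK.
  - rewrite -subset0 => x [/interior_ballP[e e_gt0 xe] /SP[y Kvy xy]].
    rewrite tuvE duvE in xy.
    have [h hP] := Ksep u v uv.
    have Kuy : K u y.
      have := xe x; rewrite subrr normr0 => /(_ e_gt0) /SP[y' Ky'].
      rewrite xy => /addrI/scalerI yy'.
      by rewrite yy' ?gt_eqF.
    have h1 : 0 < `|h| + 1 by rewrite ltr_wpDl.
    (* Small enough for the move by [s *: h], scaled by [eps ^+ d u], to stay within the [e]-ball
       around [x]. *)
    pose s := e / (`|h| + 1).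
    have s0 : 0 < s by rewrite divr_gt0.
    apply: (hP y s s0 Kuy Kvy).
    have : S u (t u + eps ^+ d u *: (y + s *: h)).
      apply: xe; rewrite xy scalerDr addrA opprD addNKr normrN !normrZ.
      rewrite !gtr0_norm//.
      apply: (@le_lt_trans _ _ (s * `|h|)).
        apply: ler_piMl; first by rewrite mulr_ge0 ?(ltW s0).
        by rewrite exprn_ile1 ?(ltW eps0).
      by rewrite /s mulrAC ltr_pdivrMr// ltr_pM2l// ltrDl.
    by move=> /SP[y' Ky' /addrI/scalerI->]; rewrite ?gt_eqF.
  - move=> Euv; rewrite -subset0 => x [/SP[y Kuy xy] /SP[y' Kvy']].
    rewrite xy tuvE duvE => /addrI/scalerI yy'.
    have : (K u `&` K v) y by split=> //; rewrite yy' ?gt_eqF.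
    by rewrite (KN _ _ uv Euv).
have Scv v : convex_set (S v : set (convex_lmodType 'rV[R]_3)).
  apply/convex_setP => x y a a0 a1 Sx Sy.
  have /convex_setP/(_ _ _ _ a0 a1 Sx Sy) := Kcv v.
  rewrite /S /=; move: (t v) (_^-1) => q k; congr (K v _).
  by apply/matrixP => i j; rewrite !mxE; ring.
exists S; split=> //.
- move=> v; apply: convex_body_region => //; last first.
    by exists (z v); apply: zint; rewrite subrr normr0 mulr_gt0.
  pose f (x : 'rV[R]_3) : 'rV[R]_3 := (eps ^+ d v)^-1 *: (x - t v).
  apply: (@preimage_closed _ _ f (K v)) => // x _.
  have cxt : {for x, continuous (fun y : 'rV[R]_3 => y - t v)}.
    apply: (@continuousB R 'rV[R]_3 'rV[R]_3 id (cst (t v)) x).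
      exact: cvg_id.
    exact: cst_continuous.
  exact: (continuousZl_tmp cxt).
- move=> u v uv; split=> [x|Svu]; first exact: Sint.
  have one0 : (const_mx 1 : 'rV[R]_3) != 0.
    by apply/eqP => /matrixP/(_ 0 0)/eqP; rewrite !mxE oner_eq0.
  (* A point at 3/4 of the inner radius: interior to [S v], but out of reach of [S u], which stays
     within 1/2. *)
  pose w := z v +
    (eps ^+ d v * (3 / 4 * r) / `|const_mx 1 : 'rV[R]_3|) *: const_mx 1.
  have wz : `|w - z v| = eps ^+ d v * (3 / 4 * r).
    rewrite /w addrAC subrr add0r normrZ gtr0_norm ?divfK ?normr_eq0//.
    by rewrite divr_gt0 ?normr_gt0// !mulr_gt0//; lra.
  have /Svu/(Sz _ _ _ uv) : interior (S v) w.
    by apply: zint; rewrite wz ltr_pM2l//; lra.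
  by rewrite wz ler_pM2l//; lra.
- move=> u v uv luv lvu.
  have [uvE uvI uvN] := incomp _ u v (ltnSn _) uv luv lvu.
  case: ifPn => /= Euv; last exact: uvN.
  split; first exact: uvE.
  rewrite -subset0 -uvI; apply: setIS; exact: interior_subset.
Qed.

(** * Interaction of the base relations on regions *)

Lemma region_interior (T : topologicalType) (X : set T) :
  region X -> interior X !=set0.
Proof.
case=> -[x Xx] Xreg; have : closure (interior X) x by rewrite Xreg.
by move=> /(_ setT filterT)[y [Xy _]]; exists y.
Qed.

(** [Y] is the closure of its interior, and an open set that meets a closure meets the set
    itself. *)
Lemma interior_disjoint_region (T : topologicalType) (X Y : set T) :
  region Y -> interior X `&` interior Y = set0 -> interior X `&` Y = set0.
Proof.
move=> [_ Yreg] XY0; rewrite -subset0 => x [Xx Yx].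
have : closure (interior Y) x by rewrite Yreg.
move=> /(_ _ (open_nbhs_nbhs (conj (open_interior X) Xx)))[y [Yy Xy]].
by have : (interior X `&` interior Y) y by []; rewrite XY0.
Qed.

Lemma NTPP_EC (T : topologicalType) (X Y Z : set T) : region Z ->
  rcc8_holds NTPP X Y -> rcc8_holds EC Y Z -> X `&` Z = set0.
Proof.
move=> regZ [XY _] [_ /(interior_disjoint_region regZ) YZ0].
by rewrite -subset0 -YZ0; exact: setSI.
Qed.

Lemma NTPP_trans (T : topologicalType) (X Y Z : set T) :
  rcc8_holds NTPP X Y -> rcc8_holds NTPP Y Z -> rcc8_holds NTPP X Z.
Proof.
move=> [XY _] [YZ ZY].
have XYs : X `<=` Y := subset_trans XY (@interior_subset _ Y).
split; first exact: subset_trans YZ.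
by move=> ZX; apply: ZY; exact: subset_trans XYs.
Qed.

Lemma NTPP_not_EC (T : topologicalType) (X Y : set T) : region X ->
  rcc8_holds NTPP X Y -> ~ rcc8_holds EC X Y.
Proof.
move=> /region_interior[x Xx] [XY _] [_]; apply/eqP/set0P.
by exists x; split=> //; apply: XY; exact: interior_subset.
Qed.

Lemma NTPP_not_DC (T : topologicalType) (X Y : set T) : region X ->
  rcc8_holds NTPP X Y -> ~ rcc8_holds DC X Y.
Proof.
move=> [[x Xx] _] [XY _]; apply/eqP/set0P.
by exists x; split=> //; apply: interior_subset; exact: XY.
Qed.

Lemma EC_sym (T : topologicalType) (X Y : set T) :
  rcc8_holds EC X Y -> rcc8_holds EC Y X.
Proof. by move=> [[x [Xx Yx]] XY0]; split; [exists x|rewrite setIC]. Qed.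

Theorem proposition14 (R : realType) (V : finType) (N : rcc8_network V)
    (Natomic : atomic N)
    (Nover : network_over [set r | r = EC \/ r = DC \/ r = NTPP \/ r = NTPPi] N)
    (Nconsistent : consistent R N) :
  exists S : V -> set 'rV[R]_3, convex_solution N S.
Proof.
have [n _ [S0 [reg0 sol0]]] := Nconsistent.
pose lt u v := `[< rcc8_holds NTPP (S0 u) (S0 v) >].
pose E u v := `[< rcc8_holds EC (S0 u) (S0 v) >].
(* The atomic constraint may be stored in either direction: EC and DC are symmetric, and NTPP and
   its converse exchange. *)
have cases u v : u <> v ->
    [\/ E u v, rcc8_holds DC (S0 u) (S0 v), lt u v | lt v u].
  move=> /Natomic[k [Nk kuv _]]; have [r kr] := sol0 k Nk.
  have := Nover k Nk r kr.
  case: kuv => -[-> ->] [|[|[|]]] -> H.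
  - by apply: Or41; apply/asboolP.
  - exact: Or42.
  - by apply: Or43; apply/asboolP.
  - by apply: Or44; apply/asboolP.
  - by apply: Or41; apply/asboolP; exact: EC_sym.
  - by apply: Or42; rewrite /= setIC.
  - by apply: Or44; apply/asboolP.
  - by apply: Or43; apply/asboolP.
have ltxx : irreflexive lt.
  by move=> u; apply/asboolP => -[_]; apply; exact: interior_subset.
have lttr : transitive lt.
  by move=> v u w /asboolP uv /asboolP vw; apply/asboolP; exact: NTPP_trans vw.
(* The interiors of [S0 v] and [S0 w] share a point of [S0 u], which rules out EC and DC. *)
have tree u v w : lt u v -> lt u w -> [\/ v = w, lt v w | lt w v].
  move=> /asboolP uv /asboolP uw.
  have [->|/eqP vw] := eqVneq v w; first exact: Or31.
  have [x ux] := region_interior (reg0 u).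
  have ux' := interior_subset ux.
  case: (cases _ _ vw) => [/asboolP[_ vw0]|vw0|?|?]; last 2 first.
  - exact: Or32.
  - exact: Or33.
  - have : (interior (S0 v) `&` interior (S0 w)) x.
      by split; [exact: uv.1|exact: uw.1].
    by rewrite vw0.
  - have : (S0 v `&` S0 w) x.
      by split; apply: interior_subset; [exact: uv.1|exact: uw.1].
    by rewrite vw0.
have Esym : symmetric E.
  by move=> u v; apply/asboolP/asboolP; exact: EC_sym.
(* The contact point [x] lies in [S0 v] and in the interior of [S0 w], against DC; EC would separate
   [S0 u] from [S0 v], and [lt w v] would nest [S0 u] in [S0 v]. *)
have sib u v w : E u v -> lt u w -> lt v w.
  move=> /asboolP uv /asboolP uw.
  have [[x [ux vx]] _] := uv.
  have [eq_vw|/eqP vw] := eqVneq v w.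
    by case: (NTPP_not_EC (reg0 u) uw); rewrite -eq_vw.
  case: (cases _ _ vw) => [/asboolP|vw0|//|/asboolP wv].
  - move=> /EC_sym /(NTPP_EC (reg0 v) uw) uv0.
    by have : (S0 u `&` S0 v) x by []; rewrite uv0.
  - have : (S0 v `&` S0 w) x.
      by split=> //; apply: interior_subset; exact: uw.1.
    by rewrite vw0.
  - by case: (NTPP_not_EC (reg0 u) (NTPP_trans uw wv)).
have [S [regS cvS ltS incS]] := nested_family R ltxx lttr tree Esym sib.
exists S; split; [split=> //|exact: cvS] => k Nk.
have [r kr kS0] := sol0 k Nk.
(* The new regions realise the same base relation as the given ones, whatever the size of
   [rels k]. *)
exists r => //.
move: (lhs k) (rhs k) kS0 (Nover k Nk r kr) => u v + rE.
have [x ux] := region_interior (reg0 u).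
case: rE => [|[|[|]]] ->.
- move=> uv; have := incS u v.
  have -> : E u v by apply/asboolP.
  apply.
  (* A constraint may relate a variable to itself; the interior point [x] excludes EC in that
     case. *)
  + apply/eqP => uvE.
    have : (interior (S0 u) `&` interior (S0 v)) x by rewrite -uvE.
    by rewrite uv.2.
  + by apply/asboolP => luv; exact: NTPP_not_EC luv uv.
  + by apply/asboolP => lvu; exact: NTPP_not_EC lvu (EC_sym uv).
- move=> uv; have := incS u v.
  have -> : E u v = false.
    by apply/asboolP => -[[z uvz] _]; have := uvz; rewrite [_ `&` _]uv.
  apply.
  + apply/eqP => uvE; have : (S0 u `&` S0 v) x.
      by rewrite -uvE; split; exact: interior_subset.
    by rewrite [_ `&` _]uv.
  + by apply/asboolP => luv; exact: NTPP_not_DC luv uv.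
  + apply/asboolP => lvu.
    by apply: (NTPP_not_DC (reg0 v) lvu); rewrite /= setIC.
- by move=> uv; apply: ltS; apply/asboolP.
- by move=> uv; apply: (ltS v u); apply/asboolP.
Qed.
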